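(* The following inequalities between cardinals are provable in $\mathsf{ZFC}$. (1) (Null ideal) $\mathfrak b(\in^*_{\mathcal N})\le \mathfrak b(\leq^*_{\mathcal N})\le \mathfrak b(\neq^*_{\mathcal N})\le \mathfrak d(\in^*_{\mathcal N})$; $\ \mathfrak b(\in^*_{\mathcal N})\le \mathfrak d(\neq^*_{\mathcal N})\le \mathfrak d(\leq^*_{\mathcal N})\le \mathfrak d(\in^*_{\mathcal N})$; and $\mathfrak b(\leq^*_{\mathcal N})\le \mathfrak d(\leq^*_{\mathcal N})$. (2) (Meager ideal) $\mathfrak b(\in^*_{\mathcal M})\le \mathfrak b(\leq^*_{\mathcal M})\le \mathfrak b(\neq^*_{\mathcal M})\le \mathfrak d(\in^*_{\mathcal M})$; $\ \mathfrak b(\in^*_{\mathcal M})\le \mathfrak d(\neq^*_{\mathcal M})\le \mathfrak d(\leq^*_{\mathcal M})\le \mathfrak d(\in^*_{\mathcal M})$; and $\mathfrak b(\leq^*_{\mathcal M})\le \mathfrak d(\leq^*_{\mathcal M})$. (3) ($\sigma$-compact ideal) $\mathfrak b(\in^*_{\mathcal K})\le \mathfrak b(\leq^*_{\mathcal K})\le \mathfrak b(\neq^*_{\mathcal K})$ and $\mathfrak d(\neq^*_{\mathcal K})\le \mathfrak d(\leq^*_{\mathcal K})\le \mathfrak d(\in^*_{\mathcal K})$. (4) (Comparison) For each $R\in\{\in^*,\leq^*,\neq^*\}$: $\mathfrak b(R_{\mathcal K})\le \mathfrak b(R_{\mathcal M})$ and $\mathfrak d(R_{\mathcal M})\le \mathfrak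 d(R_{\mathcal K})$.
   Context: $\omega^\omega$ is Baire space with Lebesgue measure $\mu$: the (completed) Borel measure with $\mu(N_s)=\prod_{i<\mathrm{length}(s)}2^{-(s(i)+1)}$ for $s\in\omega^{<\omega}$, where $N_s=\{x\in\omega^\omega: s\subseteq x\}$. $\mathcal N$ is the ideal of $\mu$-null subsets of $\omega^\omega$, $\mathcal M$ the ideal of meager subsets of $\omega^\omega$, and $\mathcal K$ the ideal of subsets of $\omega^\omega$ contained in a $\sigma$-compact set. A slalom is a function $s:\omega\to[\omega]^{<\omega}$ with $|s(n)|\le n$ for all $n$; $\mathcal S$ is the set of slaloms. For $x,y\in\omega^\omega$ and $s\in\mathcal S$: $x\leq^* y$ iff $x(n)\le y(n)$ for all but finitely many $n$; $x\neq^* y$ iff $x(n)\ne y(n)$ for all but finitely many $n$; $x\in^* s$ iff $x(n)\in s(n)$ for all but finitely many $n$. For $\mathcal I\in\{\mathcal N,\mathcal M,\mathcal K\}$, $R\in\{\leq^*,\neq^*,\in^*\}$, $f:\omega^\omega\to\omega^\omega$ and $g:\omega^\omega\to\omega^\omega$ ($g:\omega^\omega\to\mathcal S$ if $R$ is $\in^*$), write $f R_{\mathcal I} g$ iff $\{x\in\omega^\omega:\neg\, f(x) R g(x)\}\in\mathcal I$. Then $\mathfrak b(R_{\mathcal I})$ is the least size of a set $A$ of functions $\omega^\omega\to\omega^\omega$ for which there is no $g:\omega^\omega\to\omega^\omega$ (no $g:\omega^\omega\to\mathcal S$ if $R$ is $\in^*$) with $f R_{\mathcal I} g$ for all $f\in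 A$; and $\mathfrak d(R_{\mathcal I})$ is the least size of a set $A$ of functions $\omega^\omega\to\omega^\omega$ (functions $\omega^\omega\to\mathcal S$ if $R$ is $\in^*$) such that for every $g:\omega^\omega\to\omega^\omega$ there is $f\in A$ with $g R_{\mathcal I} f$. *)

(* Defs.v *)
From HB Require Import structures.
From mathcomp Require Import all_boot all_order all_algebra.
From mathcomp Require Import finmap.
From mathcomp Require Import all_classical all_reals all_analysis.
From mathcomp Require Import ring lra.
Set Implicit Arguments.
Unset Strict Implicit.
Unset Printing Implicit Defensive.
Import Order.TTheory GRing.Theory Num.Theory.
Import numFieldNormedType.Exports.
Local Open Scope classical_set_scope.
Local Open Scope card_scope.
Local Open Scope ring_scope.

Definition baire : Type := {ptws nat -> nat}.

HB.instance Definition _ := Pointed.on baire.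
HB.instance Definition _ := Nbhs.on baire.
HB.instance Definition _ := Topological.on baire.
HB.instance Definition _ := Uniform.on baire.

Definition cylinder (s : seq nat) : set baire :=
  [set x | forall i, (i < size s)%N -> x i = nth 0%N s i].

Definition borel_baire := g_sigma_algebraType (@open baire).

Definition is_baire_measure (R : realType)
    (mu : {measure set borel_baire -> \bar R}) : Prop :=
  forall s, mu (cylinder s) =
    (\prod_(i < size s) 2^-1 ^+ (nth 0%N s i).+1)%:E.

Lemma open_cylinder (s : seq nat) : open (cylinder s).
Proof.
rewrite openE => x cx; rewrite /interior.
apply: (@filterS _ (nbhs x) _
  (fun y : baire => forall i : 'I_(size s), y i = nth 0%N s i)).
  by move=> y cy i si; exact: (cy (Ordinal si)).
apply: (@filter_forall baire 'I_(size s) (fun i (y : baire) => y i = nth 0%N s i) (nbhs x)) => i.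
  have := @proj_continuous nat (fun=> nat) i x [set nth 0%N s i]; apply.
  rewrite /proj (cx i (ltn_ord i)).
  by apply: open_nbhs_nbhs; split=> //; exact: discrete_open.
Qed.

Lemma cylinder_nbhs (U : set baire) (x : baire) :
  open U -> U x -> exists n, cylinder (mkseq x n) `<=` U.
Proof.
move=> oU Ux; apply: contrapT => nU.
have /choice[y yP] : forall n, exists y : baire, cylinder (mkseq x n) y /\ ~ U y.
  move=> n; apply: contrapT => ny; apply: nU; exists n => y cy.
  by apply: contrapT => nUy; apply: ny; exists y.
have yx : {ptws, (y @ \oo) --> (x : nat -> nat)}.
  apply/pointwise_cvgP => t; apply: cvg_near_cst.
  exists t.+1 => // n /= tn; have [/(_ t) + _] := yP n.
  by rewrite size_mkseq nth_mkseq//; exact.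
have /yx[N _ NU] : nbhs (x : {ptws nat -> nat}) U by apply: open_nbhs_nbhs.
by have [_] := yP N; apply; apply: NU => /=.
Qed.

Lemma open_cylinders (U : set baire) : open U ->
  U = \bigcup_(s : seq nat) (if `[< cylinder s `<=` U >] then cylinder s else set0).
Proof.
move=> oU; apply/seteqP; split=> x.
  move=> Ux; have [n nU] := cylinder_nbhs oU Ux; exists (mkseq x n) => //.
  by rewrite (asboolT nU) => i; rewrite size_mkseq => ?; rewrite nth_mkseq.
by move=> [s _]; case: asboolP => // /[apply].
Qed.

Section baire_measure.
Context (R : realType).

(* The measure is realised as the law, under Lebesgue measure on [0, 1[, of the
   digit sequence of the partition of [0, 1[ into the intervals
   [1 - 2^-n, 1 - 2^-(n+1)[, iterated inside each piece. *)
Let cut (n : nat) : R := 1 - 2^-1 ^+ n.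
Let dig (t : R) : nat := xget 0%N [set n | cut n <= t < cut n.+1].
Let shift (t : R) : R := (t - cut (dig t)) * 2 ^+ (dig t).+1.
Let digits (t : R) : baire := fun n => dig (iter n shift t).
Let dmap (t : R) : borel_baire :=
  if (0 <= t) && (t < 1) then digits t else fun=> 0%N.

Let cutS n : cut n.+1 = cut n + 2^-1 ^+ n.+1.
Proof. by rewrite /cut exprS; lra. Qed.

Let cut0 : cut 0 = 0. Proof. by rewrite /cut expr0 subrr. Qed.

Let cut_lt1 n : cut n < 1.
Proof. by rewrite /cut ltrBlDr ltrDl exprn_gt0// invr_gt0. Qed.

Let cut_le m n : (m <= n)%N -> cut m <= cut n.
Proof.
move=> mn; rewrite /cut lerD2l lerN2 ler_wiXn2l ?invr_ge0//.
by rewrite invf_le1 ?ler1n.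
Qed.

Let dig_spec (t : R) : 0 <= t < 1 -> cut (dig t) <= t < cut (dig t).+1.
Proof.
move=> /andP[t0 t1]; rewrite /dig; apply: (@xgetPex _ 0%N [set n | cut n <= t < cut n.+1]).
have ex : exists n, t < cut n.
  have : (fun n => 2^-1 ^+ n : R) @ \oo --> 0.
    by apply: cvg_expr; rewrite gtr0_norm ?invr_gt0// invf_lt1 ?ltr1n.
  have d0 : 0 < 1 - t by rewrite subr_gt0.
  move=> /cvgrPdist_lt /(_ _ d0)[N _ /(_ N (leqnn N))] /=.
  rewrite sub0r normrN gtr0_norm ?exprn_gt0 ?invr_gt0// => h.
  by exists N; rewrite /cut; lra.
case: (ex_minnP ex) => -[|n]; first by rewrite cut0 ltNge t0.
move=> tn nmin; exists n => /=; rewrite tn andbT leNgt.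
by apply/negP => /nmin; rewrite ltnn.
Qed.

Let digE (t : R) n : 0 <= t < 1 -> (dig t = n) <-> (cut n <= t < cut n.+1).
Proof.
move=> t01; split=> [<-|/andP[nt tn]]; first exact: dig_spec.
have /andP[dt td] := dig_spec t01.
case: (ltngtP (dig t) n) => // h.
  by have := le_lt_trans (le_trans (cut_le h) nt) td; rewrite ltxx.
by have := le_lt_trans (le_trans (cut_le h) dt) tn; rewrite ltxx.
Qed.

Let shift01 (t : R) : 0 <= t < 1 -> 0 <= shift t < 1.
Proof.
move=> /dig_spec; rewrite cutS /shift => /andP[h1 h2].
rewrite mulr_ge0 ?subr_ge0 ?exprn_ge0//=.
by rewrite -ltr_pdivlMr ?exprn_gt0// mul1r -exprVn ltrBlDl.
Qed.

Fixpoint lo (s : seq nat) : R :=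
  if s is n :: s' then cut n + 2^-1 ^+ n.+1 * lo s' else 0.
Let len (s : seq nat) : R := \prod_(i < size s) 2^-1 ^+ (nth 0%N s i).+1.

Let len_cons n s : len (n :: s) = 2^-1 ^+ n.+1 * len s.
Proof. by rewrite /len/= big_ord_recl. Qed.

Let len_gt0 s : 0 < len s.
Proof. by apply: prodr_gt0 => i _; rewrite exprn_gt0// invr_gt0. Qed.

Let lo01 s : 0 <= lo s /\ lo s + len s <= 1.
Proof.
elim: s => [|n s [ih1 ih2]] /=; first by rewrite /len big_ord0 add0r lexx.
have p : 0 < 2^-1 ^+ n.+1 :> R by rewrite exprn_gt0// invr_gt0.
split; first by rewrite addr_ge0 ?(mulr_ge0 (ltW p))// -cut0 cut_le.
rewrite len_cons -addrA -mulrDr.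
apply: (@le_trans _ _ (cut n.+1)); last exact/ltW/cut_lt1.
by rewrite cutS lerD2l ler_piMr// ltW.
Qed.

Let digits_cylinder (s : seq nat) (t : R) : 0 <= t < 1 ->
  cylinder s (digits t) <-> lo s <= t < lo s + len s.
Proof.
elim: s t => [|n s ih] t t01.
  by rewrite /len big_ord0 add0r /= t01; split.
have -> : cylinder (n :: s) (digits t) <->
    dig t = n /\ cylinder s (digits (shift t)).
  split=> [h|[h1 h2] [|i]] //=.
    split; first exact: (h 0%N).
    by move=> i si; have := h i.+1 si; rewrite /digits iterSr.
  by rewrite ltnS => /h2; rewrite /digits iterSr.
have p : 0 < 2^-1 ^+ n.+1 :> R by rewrite exprn_gt0// invr_gt0.
have [l1 l2] := lo01 s; have lg := len_gt0 s.
have key : (dig t = n) ->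
    (lo s <= shift t < lo s + len s) =
    (cut n + 2^-1 ^+ n.+1 * lo s <= t < cut n + 2^-1 ^+ n.+1 * (lo s + len s)).
  move=> dn; rewrite /shift dn.
  rewrite -[_ + _ * lo s <= t]lerBrDl -[t < _ + _]ltrBlDl.
  by rewrite exprVn ler_pdivrMl ?exprn_gt0// ltr_pdivlMl ?exprn_gt0// mulrC.
rewrite len_cons /= -[X in _ < X]addrA -mulrDr; split.
  by move=> [dn /(ih _ (shift01 t01))]; rewrite key.
move=> h; have dn : dig t = n.
  apply/(digE _ t01); case/andP: h => h1 h2; apply/andP; split.
    by apply: le_trans h1; rewrite lerDl mulr_ge0// ltW.
  by apply: (lt_le_trans h2); rewrite cutS lerD2l ler_piMr// ltW.
by split=> //; apply/(ih _ (shift01 t01)); rewrite key.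
Qed.

Let dmap_cylinder s : [set t : R | 0 <= t < 1] `&` dmap @^-1` cylinder s =
  [set` `[lo s, lo s + len s[].
Proof.
have [l1 l2] := lo01 s.
apply/seteqP; split=> t /=; rewrite in_itv/=.
  by move=> [t01]; rewrite /dmap t01 => /(digits_cylinder s t01).
move=> h; have t01 : 0 <= t < 1.
  case/andP: h => h1 h2; rewrite (le_trans l1 h1)/=.
  exact: lt_le_trans h2 l2.
by split=> //; rewrite /dmap t01; exact/(digits_cylinder s t01).
Qed.

Let I01E : [set t : R | 0 <= t < 1] = [set` `[0, 1[ ].
Proof. by apply/seteqP; split=> t /=; rewrite in_itv. Qed.

Let mI01 : measurable [set t : R | 0 <= t < 1].
Proof. by rewrite I01E. Qed.

Let measurable_dmap : measurable_fun [set: R] dmap.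
Proof.
apply: (@measurability _ _ _ borel_baire _ _ (@open baire)) => //.
move=> _ [U oU <-]; rewrite setTI (open_cylinders oU) preimage_bigcup.
apply: countable_bigcupT_measurable => [|s]; first exact: countableP.
case: asboolP => _; last by rewrite preimage_set0.
rewrite -(setIT (_ @^-1` _)) -(setUv [set t : R | 0 <= t < 1]) setIUr.
apply: measurableU; first by rewrite setIC dmap_cylinder.
have [c0|c0] := pselect (cylinder s (fun=> 0%N)).
  rewrite (_ : _ `&` _ = ~` [set t : R | 0 <= t < 1]); first exact: measurableC.
  by apply/seteqP; split=> t /=; [case|move=> /negP nt; rewrite /dmap (negbTE nt)].
rewrite (_ : _ `&` _ = set0)//; apply/seteqP; split=> t //= [].
by rewrite /dmap => + /negP nt; rewrite (negbTE nt).
Qed.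

Lemma is_baire_measure_ex :
  exists mu : {measure set borel_baire -> \bar R}, is_baire_measure mu.
Proof.
exists (pushforward (mrestr (@lebesgue_measure R) mI01) dmap).
move=> s.
rewrite /= /pushforward /mrestr setIC dmap_cylinder lebesgue_measure_itv/=.
by rewrite lte_fin ltrDl len_gt0 -EFinD addrC addKr.
Unshelve. exact: measurable_dmap.
Qed.

Lemma is_baire_measure_unique (mu nu : {measure set borel_baire -> \bar R}) :
  is_baire_measure mu -> is_baire_measure nu ->
  forall A, measurable A -> mu A = nu A.
Proof.
move=> muP nuP A mA.
pose G : set (set borel_baire) := set0 |` range cylinder.
have oG : G `<=` @open baire by move=> _ [->|[s _ <-]]; [exact: open0|exact: open_cylinder].
have cT : cylinder [::] = setT by apply/seteqP; split.
have GT : G setT by right; exists [::].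
have GI : setI_closed G.
  have main s s' : (size s <= size s')%N -> G (cylinder s `&` cylinder s').
    move=> ss'.
    have [h|h] := pselect (forall i, (i < size s)%N -> nth 0%N s i = nth 0%N s' i).
      right; exists s' => //; apply/seteqP; split=> [x c|x []//].
      split=> // i si; rewrite h//; apply: c; exact: leq_trans si ss'.
    left; apply/seteqP; split=> // x [c1 c2]; apply: h => i si.
    by rewrite -c1// c2//; exact: leq_trans si ss'.
  move=> _ _ [->|[s _ <-]] [->|[s' _ <-]]; rewrite ?set0I ?setI0; try by left.
  by have [/main//|/ltnW/main] := leqP (size s) (size s'); rewrite setIC.
apply: (@g_sigma_algebra_measure_unique _ R borel_baire G _ (fun=> setT)) => //.
- by move=> B /oG; exact: sub_sigma_algebra.
- by rewrite bigcup_const.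
- by move=> B [->|[s _ <-]]; rewrite ?measure0// muP nuP.
- by move=> _; rewrite -cT muP ltry.
- move: A mA; apply: smallest_sub; first exact: smallest_sigma_algebra.
  move=> U oU; rewrite (open_cylinders oU).
  pose GS := g_sigma_algebraType G.
  apply: (@countable_bigcupT_measurable _ GS); first exact: countableP.
  move=> s; apply: sub_sigma_algebra.
  by case: asboolP => _; [right; exists s|left].
Qed.

Definition baire_measure : {measure set borel_baire -> \bar R} :=
  sval (cid is_baire_measure_ex).

Lemma baire_measureP : is_baire_measure baire_measure.
Proof. exact: (svalP (cid is_baire_measure_ex)). Qed.

End baire_measure.

(* Subsets of Borel null sets, i.e. the null sets of the completion. *)
Definition null_ideal (R : realType) : set (set baire) :=
  (baire_measure R).-negligible.

Definition nowhere_dense (A : set baire) : Prop := (closure A)° = set0.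

Definition meager_ideal : set (set baire) :=
  [set A | exists F : (set baire)^nat,
    (forall n, nowhere_dense (F n)) /\ A = \bigcup_n F n].

Definition sigma_compact_ideal : set (set baire) :=
  [set A | exists F : (set baire)^nat,
    (forall n, compact (F n)) /\ A `<=` \bigcup_n F n].

Record slalom := Slalom {
  slalom_fun :> nat -> {fset nat};
  slalom_card : forall n, (#|` slalom_fun n| <= n)%N }.

Definition le_star (x y : baire) : Prop :=
  \forall n \near \oo, (x n <= y n)%N.

Definition neq_star (x y : baire) : Prop :=
  \forall n \near \oo, x n != y n.

Definition in_star (x : baire) (s : slalom) : Prop :=
  \forall n \near \oo, x n \in s n.

(* Cardinals are represented by sets compared with [#<=]: [least_size P] is a
   chosen member of P of least cardinality, which exists as soon as P is
   nonempty ([least_sizeP]). *)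
Definition least_size (T : Type) (P : set (set T)) : set T :=
  xget set0 [set A | P A /\ forall B, P B -> A #<= B].

Lemma least_size_ex (T : Type) (P : set (set T)) :
  P !=set0 -> exists A, P A /\ forall B, P B -> A #<= B.
Proof.
move=> [A0 PA0].
have [A0n|/set0P[t0 _]] := eqVneq A0 set0.
  by exists A0; split=> // B _; rewrite A0n; exact: card_ge0.
pose sel : set (set (set T -> T)) := [set C |
  (forall phi, C phi -> forall A, P A -> A (phi A)) /\
  (forall phi psi A, C phi -> C psi -> P A -> phi A = psi A -> phi = psi)].
have [|C [[Csel Cinj] Cmax]] := @Zorn_bigcup _ sel.
  move=> F Fsel Ftot; split.
    by move=> phi [C FC Cphi]; have [+ _] := Fsel _ FC; exact.
  move=> phi psi A [C FC Cphi] [D FD Dpsi].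
  have [CD|DC] := Ftot _ _ FC FD.
    by have [_ inj] := Fsel _ FD; apply: inj => //; exact: CD.
  by have [_ inj] := Fsel _ FC; apply: inj => //; exact: DC.
have [[A PA surj]|nosurj] :=
    pselect (exists2 A, P A & forall a, A a -> exists2 phi, C phi & phi A = a).
  exists A; split=> // B PB.
  have evinj D : P D -> {in C &, injective (fun phi : set T -> T => phi D)}.
    by move=> PD phi psi /set_mem Cphi /set_mem Cpsi; exact: Cinj.
  apply: (@card_le_trans _ _ _ ((fun phi => phi A) @` C)).
    by apply: subset_card_le => a /surj[phi Cphi <-]; exists phi.
  rewrite (card_le_eql (inj_card_eq (evinj _ PA))).
  rewrite -(card_le_eql (inj_card_eq (evinj _ PB))).
  by apply: subset_card_le => _ [phi Cphi <-]; exact: (Csel phi Cphi B PB).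
have /choice[psi psiP] : forall A, exists a,
    P A -> A a /\ forall phi, C phi -> phi A <> a.
  move=> A; have [PA|nPA] := pselect (P A); last by exists t0.
  apply: contrapT => noa; apply: nosurj; exists A => // a Aa.
  apply: contrapT => nophi; apply: noa; exists a => _; split=> // phi Cphi phia.
  by apply: nophi; exists phi.
exfalso; apply: (Cmax (C `|` [set psi])).
  split; first by move=> phi; left.
  move=> sub; have /sub Cpsi : (C `|` [set psi]) psi by right.
  by have [_ /(_ _ Cpsi)] := psiP _ PA0; apply.
split.
  by move=> phi [/Csel//|->] A /psiP[].
move=> phi1 phi2 A [C1|->] [C2|->] PA //; first exact: Cinj.
- by have [_ /(_ _ C1)] := psiP _ PA.
- by have [_ /(_ _ C2) + /esym] := psiP _ PA.
Qed.

Lemma least_sizeP (T : Type) (P : set (set T)) : P !=set0 ->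
  P (least_size P) /\ forall B, P B -> least_size P #<= B.
Proof. by move=> /least_size_ex; exact: xgetPex. Qed.

(* The target Y is [baire] for [le_star] and [neq_star], [slalom] for
   [in_star]. *)
Section cardinals.
Context (Y : Type) (Rel : baire -> Y -> Prop) (I : set (set baire)).

Definition rel_mod (f : baire -> baire) (g : baire -> Y) : Prop :=
  I [set x | ~ Rel (f x) (g x)].

Definition frak_b : set (baire -> baire) :=
  least_size [set A : set (baire -> baire) |
    ~ exists g : baire -> Y, forall f, A f -> rel_mod f g].

Definition frak_d : set (baire -> Y) :=
  least_size [set A : set (baire -> Y) |
    forall g : baire -> baire, exists2 f, A f & rel_mod g f].

End cardinals.

(* Main.v *)
(** A pair of maps translating one relation into another ([Rel1 (phi x) y ->
    Rel2 x (psi y)]) acts pointwise on functions and compares both cardinals of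
    the two relations; a map into the dual relation compares [frak_b] with
    [frak_d].  The only translation that is not a bound or a successor is
    between [in_star] and [neq_star]: if a slalom captures the codes of the
    restrictions of [g] to disjoint blocks, the n-th block having n points,
    then diagonalizing over the at most n guesses for the n-th block gives a
    function which meets [g] on almost every block.  The comparison of the
    sigma-compact and meager ideals only uses that compact sets are nowhere
    dense. *)
Require Import Defs.
From mathcomp Require Import all_boot all_order all_algebra.
From mathcomp Require Import finmap.
From mathcomp Require Import all_classical all_reals all_analysis.
Set Implicit Arguments.
Unset Strict Implicit.
Unset Printing Implicit Defensive.
Local Open Scope classical_set_scope.
Local Open Scope card_scope.

(** * Comparing least sizes by translations *)

Lemma least_size_le (T U : Type) (P : set (set T)) (Q : set (set U)) :
  Q !=set0 -> (forall B, Q B -> exists2 A, P A & A #<= B) ->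
  least_size P #<= least_size Q.
Proof.
move=> Q0 PQ; have [QB _] := least_sizeP Q0.
have [A PA AB] := PQ _ QB; apply: card_le_trans AB.
by have [|_] := @least_sizeP _ P; [exists A | exact].
Qed.

Record proper_ideal (I : set (set baire)) : Prop := ProperIdeal {
  ideal0 : I set0;
  idealS : forall A B, A `<=` B -> I B -> I A;
  idealU : forall A B, I A -> I B -> I (A `|` B);
  idealT : ~ I setT }.

(** Guarantees that [frak_b] is a genuine minimum and not a default value. The set of all functions
    has no bound [g]: choosing at each point a value unrelated to that of [g] makes the exceptional
    set the whole space. *)
Lemma unbounded_ex (Y : Type) (Rel : baire -> Y -> Prop) (I : set (set baire)) :
    proper_ideal I -> (forall y, exists x, ~ Rel x y) ->
  [set A : set (baire -> baire) |
    ~ exists g : baire -> Y, forall f, A f -> rel_mod Rel I f g] !=set0.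
Proof.
move=> pI /choice[h hP]; exists setT => -[g /(_ (h \o g) Logic.I) Ig].
by apply: (idealT pI); apply: (idealS pI) Ig => x _; exact: hP.
Qed.

Lemma dominating_ex (Y : Type) (Rel : baire -> Y -> Prop) (I : set (set baire)) :
    proper_ideal I -> (forall x, exists y, Rel x y) ->
  [set A : set (baire -> Y) |
    forall g, exists2 f, A f & rel_mod Rel I g f] !=set0.
Proof.
move=> pI /choice[h hP]; exists setT => g; exists (h \o g) => //.
by apply: (idealS pI) (ideal0 pI) => x; apply; exact: hP.
Qed.

Section tukey.
Variables (Y1 Y2 : Type) (Rel1 : baire -> Y1 -> Prop) (Rel2 : baire -> Y2 -> Prop).

Lemma rel_mod_tukey (I J : set (set baire)) (phi : baire -> baire) (psi : Y1 -> Y2)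
    (f : baire -> baire) (g : baire -> Y1) :
    proper_ideal J -> I `<=` J ->
    (forall x y, Rel1 (phi x) y -> Rel2 x (psi y)) ->
  rel_mod Rel1 I (phi \o f) g -> rel_mod Rel2 J f (psi \o g).
Proof.
move=> pJ IJ H /IJ; apply: (idealS pJ) => x /= nR /H; exact: nR.
Qed.

Lemma frak_b_tukey (I J : set (set baire)) (phi : baire -> baire) (psi : Y1 -> Y2) :
    proper_ideal J -> I `<=` J ->
    (forall x y, Rel1 (phi x) y -> Rel2 x (psi y)) ->
    (forall y, exists x, ~ Rel2 x y) ->
  frak_b Rel1 I #<= frak_b Rel2 J.
Proof.
move=> pJ IJ H nR2; apply: least_size_le; first exact: unbounded_ex.
move=> B nB; exists ((fun f => phi \o f) @` B); last exact: card_image_le.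
move=> [g gP]; apply: nB; exists (psi \o g) => f Bf.
by apply: (rel_mod_tukey pJ IJ H); apply: gP; exists f.
Qed.

Lemma frak_d_tukey (I J : set (set baire)) (phi : baire -> baire) (psi : Y1 -> Y2) :
    proper_ideal I -> proper_ideal J -> I `<=` J ->
    (forall x y, Rel1 (phi x) y -> Rel2 x (psi y)) ->
    (forall x, exists y, Rel1 x y) ->
  frak_d Rel2 J #<= frak_d Rel1 I.
Proof.
move=> pI pJ IJ H R1; apply: least_size_le; first exact: dominating_ex.
move=> B dB; exists ((fun f => psi \o f) @` B); last exact: card_image_le.
move=> g; have [f Bf Rf] := dB (phi \o g); exists (psi \o f); first by exists f.
exact: rel_mod_tukey pJ IJ H Rf.
Qed.

(** If [h] bounded the image under [psi] of a dominating family, some [f] in the family would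
    dominate [phi \o h]. At every point one of the two relations fails, so two sets of the ideal
    would cover the space. *)
Lemma frak_b_le_d (I : set (set baire)) (phi : Y1 -> baire) (psi : Y2 -> baire) :
    proper_ideal I ->
    (forall u v, Rel2 (phi u) v -> ~ Rel1 (psi v) u) ->
    (forall x, exists y, Rel2 x y) ->
  frak_b Rel1 I #<= frak_d Rel2 I.
Proof.
move=> pI H R2; apply: least_size_le; first exact: dominating_ex.
move=> B dB; exists ((fun f => psi \o f) @` B); last exact: card_image_le.
move=> [h hP]; have [f Bf Rf] := dB (phi \o h).
have {}hP : rel_mod Rel1 I (psi \o f) h by apply: hP; exists f.
apply: (idealT pI); apply: (idealS pI) (idealU pI Rf hP) => x _ /=.
by have [/H|] := pselect (Rel2 (phi (h x)) (f x)); [right|left].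
Qed.

End tukey.

(** * Translations between the three relations *)

Definition succ_baire (x : baire) : baire := fun n => (x n).+1.

Lemma le_star_neq_succ (x y : baire) : le_star x y -> neq_star x (succ_baire y).
Proof. by apply: filterS => n xy; rewrite neq_ltn ltnS xy. Qed.

Lemma le_star_refl (x : baire) : le_star x x.
Proof. exact: nearW. Qed.

Lemma le_star_succN (x y : baire) : le_star (succ_baire x) y -> ~ le_star y x.
Proof.
move=> xy yx; have [n [h1 h2]] := filter_ex (filterI xy yx).
by have := leq_trans h1 h2; rewrite ltnn.
Qed.

Definition slalom_max (s : slalom) : baire := fun n => \max_(i <- s n) i.

Lemma in_star_le_max (x : baire) (s : slalom) :
  in_star x s -> le_star x (slalom_max s).
Proof. by apply: filterS => n xs; exact: (@leq_bigmax_seq _ _ xpredT id). Qed.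

Lemma in_star_ex (x : baire) : exists s, in_star x s.
Proof.
(* The bound [n] on the size forces the value at 0 to be empty. *)
pose s n := if n is 0%N then fset0 else [fset x n]%fset.
have sle n : (#|` s n| <= n)%N by case: n => [|n]; rewrite /= ?cardfs0 ?cardfs1.
exists (Slalom sle); exists 1%N => // -[//|n] _ /=; exact: fset11.
Qed.

(* Block n consists of the points 2^n * 3^i with i < n. *)
Definition block_code (x : baire) : baire :=
  fun n => choice.pickle (mkseq (fun i => x (2 ^ n * 3 ^ i)%N) n).

(** The exponents of 2 and 3 recover [n] and [i] from a block point; the value is entry [i] of the
    sequence coded by the [i]-th element listed in [s n]. The defaults cover arguments where no such
    code exists. *)
Definition slalom_diag (s : slalom) : baire := fun k =>
  let i := logn 3 k in
  nth 0%N (odflt [::] (choice.unpickle (nth 0%N (s (logn 2 k)) i))) i.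

Lemma slalom_diag_block (x : baire) (s : slalom) n : block_code x n \in s n ->
  exists i, slalom_diag s (2 ^ n * 3 ^ i)%N = x (2 ^ n * 3 ^ i)%N.
Proof.
move=> xs; exists (index (block_code x n) (s n)).
set i := index _ _.
(* As [s n] has at most [n] elements, the position of the correct guess is also the index of a point
   of block [n]. *)
have i_lt_n : (i < n)%N.
  by apply: leq_trans (slalom_card s n); rewrite index_mem.
have log2 : logn 2 (2 ^ n * 3 ^ i) = n.
  by rewrite lognM ?expn_gt0// !lognX !logn_prime//= muln1 muln0 addn0.
have log3 : logn 3 (2 ^ n * 3 ^ i) = i.
  by rewrite lognM ?expn_gt0// !lognX !logn_prime//= muln1 muln0.
rewrite /slalom_diag log2 log3 nth_index; last by rewrite xs.
by rewrite choice.pickleK/= nth_mkseq.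
Qed.

Lemma in_star_block_diagN (x : baire) (s : slalom) :
  in_star (block_code x) s -> ~ (\forall n \near \oo, slalom_diag s n != x n).
Proof.
move=> [N _ Ns] [M _ MP].
have [i xi] := slalom_diag_block (Ns _ (leq_maxl N M)).
have /= := MP (2 ^ maxn N M * 3 ^ i)%N; rewrite xi eqxx => h.
suff /h : (M <= 2 ^ maxn N M * 3 ^ i)%N by [].
(* The agreement point lies beyond [M] because 2^n exceeds [n]. *)
apply: leq_trans (leq_maxr N M) _; apply: leq_trans (leq_pmulr _ _).
  exact/ltnW/ltn_expl.
by rewrite expn_gt0.
Qed.

(** * Baire category and compact sets *)

Lemma interleave_bigcup (F G : (set baire)^nat) :
  \bigcup_n F n `|` \bigcup_n G n =
  \bigcup_n (if odd n then F n./2 else G n./2).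
Proof.
apply/seteqP; split=> [x [[n _ Fx]|[n _ Gx]]|x [n _]].
- by exists n.*2.+1 => //=; rewrite odd_double uphalf_double.
- by exists n.*2 => //=; rewrite odd_double doubleK.
- by case: (odd n) => ?; [left|right]; exists n./2.
Qed.

Lemma nowhere_denseS (A B : set baire) :
  A `<=` B -> nowhere_dense B -> nowhere_dense A.
Proof.
move=> AB B0; apply/seteqP; split=> // x.
by rewrite -B0; apply: interiorS; exact: closure_subset.
Qed.

(** The cylinder has a point off the closure of [A], hence a smaller cylinder missing [A]. Strict
    growth of the prefix makes the iteration converge. *)
Lemma nowhere_dense_avoid (A : set baire) (x : baire) m : nowhere_dense A ->
  exists y k, [/\ cylinder (mkseq x m) y, (m < k)%N
    & cylinder (mkseq y k) `&` A = set0].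
Proof.
move=> A0; have [y xy Ay] : exists2 y, cylinder (mkseq x m) y & ~ closure A y.
  apply: contrapT => h; suff : (closure A)° x by rewrite A0.
  apply: (@filterS _ (nbhs x) _ (cylinder (mkseq x m))).
    by move=> y xy; apply: contrapT => nAy; apply: h; exists y.
  apply: open_nbhs_nbhs; split; first exact: open_cylinder.
  by move=> i; rewrite size_mkseq => im; rewrite nth_mkseq.
have [n ny] := cylinder_nbhs (closed_openC (@closed_closure _ A)) Ay.
exists y, (maxn m.+1 n); split=> //; first exact: leq_maxl.
apply/seteqP; split=> // z [yz Az]; apply: (ny z); last exact: subset_closure.
move=> i; rewrite size_mkseq => im; have := yz i.
by rewrite size_mkseq !nth_mkseq// ?leq_max ?im ?orbT// => /(_ isT).
Qed.

Lemma baire_category (F : (set baire)^nat) :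
  (forall n, nowhere_dense (F n)) -> \bigcup_n F n <> setT.
Proof.
move=> F0.
have /choice[step stepP] : forall p : nat * (baire * nat), exists q : baire * nat,
    [/\ forall i, (i < p.2.2)%N -> q.1 i = p.2.1 i, (p.2.2 < q.2)%N
      & cylinder (mkseq q.1 q.2) `&` F p.1 = set0].
  move=> [n [x m]]; have [y [k [xy mk yF]]] := nowhere_dense_avoid x m (F0 n).
  exists (y, k); split=> //= i im.
  by have := xy i; rewrite size_mkseq nth_mkseq// => /(_ im).
(* The pair [u n] stands for a prefix: a point and the number of its coordinates already fixed. *)
pose u := fix u n := if n is n'.+1 then step (n', u n') else (fun=> 0%N, 0%N).
have u_lt n : ((u n).2 < (u n.+1).2)%N by have [] := stepP (n, u n).
have u_ge n : (n <= (u n).2)%N by elim: n => // n /leq_ltn_trans; exact.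
have uE n j i : (i < (u n).2)%N -> (u (n + j)%N).1 i = (u n).1 i.
  move=> iu; elim: j => [|j IH]; first by rewrite addn0.
  rewrite addnS -IH; have [+ _ _] := stepP ((n + j)%N, u (n + j)%N); apply=> /=.
  apply: leq_trans iu _; elim: j {IH} => [|j IH]; first by rewrite addn0.
  by rewrite addnS; apply: leq_trans IH (ltnW (u_lt _)).
(* At stage [i.+1] more than [i] coordinates are fixed, so coordinate [i] is final. *)
pose z : baire := fun i => (u i.+1).1 i.
have zE n i : (i < (u n).2)%N -> z i = (u n).1 i.
  move=> iu; rewrite /z; have [ni|ni] := leqP n i.+1.
    by rewrite -(subnKC ni) uE.
  by rewrite -[in RHS](subnKC (ltnW ni)) uE.
move=> FT; have [n _ Fz] : (\bigcup_n F n) z by rewrite FT.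
have [_ _ /seteqP[/(_ z) + _]] := stepP (n, u n); apply; split=> //= i.
by rewrite size_mkseq => iu; rewrite nth_mkseq// (zE n.+1).
Qed.

(** A cylinder of length [n] inside the closure would make coordinate [n] take every value on [C],
    whereas compactness bounds each coordinate. *)
Lemma compact_nowhere_dense (C : set baire) : compact C -> nowhere_dense C.
Proof.
move=> cC; apply/seteqP; split=> // x.
move=> /(cylinder_nbhs (@open_interior _ _))[n nC].
have /choice[y yP] : forall m, exists y : baire, C y /\ y n = m.
  move=> m; pose w : baire := fun i => if (i < n)%N then x i else m.
  have /nC/interior_subset : cylinder (mkseq x n) w.
    by move=> i; rewrite size_mkseq => im; rewrite nth_mkseq// /w im.
  move=> /(_ (cylinder (mkseq w n.+1)))[].
    apply: open_nbhs_nbhs; split; first exact: open_cylinder.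
    by move=> i; rewrite size_mkseq => im; rewrite nth_mkseq.
  move=> y [Cy wy]; exists y; split=> //.
  by have := wy n; rewrite size_mkseq nth_mkseq// /w ltnn; exact.
have yC : (y @ \oo) C by exists 0%N => // m _; have [] := yP m.
have [z [Cz zP]] := cC (y @ \oo) _ yC.
(* A cluster point [z] forces some [y m] with [m] above [z n] to agree with [z] at coordinate [n],
   where [y m] has value [m]. *)
have [||w [[m [mz <-]] wz]] := zP [set y m | m in [set m | (z n < m)%N]]
    (cylinder (mkseq z n.+1)).
- by exists (z n).+1 => // m /= zm; exists m.
- apply: open_nbhs_nbhs; split; first exact: open_cylinder.
  by move=> i; rewrite size_mkseq => im; rewrite nth_mkseq.
have := wz n; rewrite size_mkseq nth_mkseq// (yP m).2 => /(_ (ltnSn n)) mE.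
by move: mz; rewrite /= mE ltnn.
Qed.

Lemma sigma_compact_meager : sigma_compact_ideal `<=` meager_ideal.
Proof.
(* Meagerness asks for equality with the union, hence the intersections with [A]. *)
move=> A [F [cF AF]]; exists (fun n => A `&` F n); split.
  by move=> n; apply: nowhere_denseS (compact_nowhere_dense (cF n)) => x [].
by rewrite -setI_bigcupr; apply/esym/setIidPl.
Qed.

(** * Properness of the three ideals *)

Lemma meager_proper : proper_ideal meager_ideal.
Proof.
have nd0 : nowhere_dense set0 by rewrite /nowhere_dense closure0 interior0.
split.
- by exists (fun=> set0); split=> //; rewrite bigcup0.
- move=> A B AB [F [F0 BF]]; exists (fun n => A `&` F n); split.
    by move=> n; apply: nowhere_denseS (F0 n) => x [].
  by rewrite -setI_bigcupr -BF; apply/esym/setIidPl.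
- move=> _ _ [F [F0 ->]] [G [G0 ->]].
  exists (fun n => if odd n then F n./2 else G n./2); split.
    by move=> n; case: ifP.
  exact: interleave_bigcup.
- by move=> [F [F0 /esym]]; exact: baire_category.
Qed.

Lemma sigma_compact_proper : proper_ideal sigma_compact_ideal.
Proof.
split.
- by exists (fun=> set0); split=> // n; exact: compact0.
- by move=> A B AB [F [cF BF]]; exists F; split=> //; exact: subset_trans BF.
- move=> A B [F [cF AF]] [G [cG BG]].
  exists (fun n => if odd n then F n./2 else G n./2); split.
    by move=> n; case: ifP.
  by rewrite -interleave_bigcup; exact: setUSS.
- by move=> /sigma_compact_meager; exact: idealT meager_proper.
Qed.

Lemma null_proper (R : realType) : proper_ideal (null_ideal R).
Proof.
split.
- exact: (negligible_set0 (baire_measure R)).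
- move=> A B; exact: (@negligibleS _ _ _ (baire_measure R)).
- move=> A B; exact: (@negligibleU _ _ _ (baire_measure R)).
- move=> /(negligibleP (baire_measure R) measurableT) muT.
  (* The empty prefix gives the whole space the empty product, 1, as measure. *)
  have := baire_measureP R [::].
  have -> : cylinder [::] = setT by apply/seteqP; split.
  by rewrite big_ord0 muT => -[] /eqP; rewrite eq_sym GRing.oner_eq0.
Qed.

(** * The inequalities for an arbitrary proper ideal *)

Lemma le_star_exN (y : baire) : exists x, ~ le_star x y.
Proof. by exists (succ_baire y) => /le_star_succN; apply; exact: le_star_refl. Qed.

Lemma neq_star_exN (y : baire) : exists x, ~ neq_star x y.
Proof. by exists y => /filter_ex[n]; rewrite eqxx. Qed.

Lemma in_star_exN (s : slalom) : exists x, ~ in_star x s.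
Proof.
by have [x xs] := le_star_exN (slalom_max s); exists x => /in_star_le_max.
Qed.

Section cichon.
Variables (I : set (set baire)) (pI : proper_ideal I).

Lemma frak_b_in_le : frak_b in_star I #<= frak_b le_star I.
Proof.
exact: (frak_b_tukey (phi := id) (psi := slalom_max) pI (@subset_refl _ I)
  in_star_le_max le_star_exN).
Qed.

Lemma frak_b_le_neq : frak_b le_star I #<= frak_b neq_star I.
Proof.
exact: (frak_b_tukey (phi := id) (psi := succ_baire) pI (@subset_refl _ I)
  le_star_neq_succ neq_star_exN).
Qed.

Lemma frak_d_neq_le : frak_d neq_star I #<= frak_d le_star I.
Proof.
apply: (frak_d_tukey (phi := id) (psi := succ_baire) pI pI
  (@subset_refl _ I) le_star_neq_succ).
by move=> x; exists x; exact: le_star_refl.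
Qed.

Lemma frak_d_le_in : frak_d le_star I #<= frak_d in_star I.
Proof.
exact: (frak_d_tukey (phi := id) (psi := slalom_max) pI pI (@subset_refl _ I)
  in_star_le_max in_star_ex).
Qed.

Lemma frak_b_neq_d_in : frak_b neq_star I #<= frak_d in_star I.
Proof.
exact: (frak_b_le_d pI in_star_block_diagN in_star_ex).
Qed.

(** The block argument again, contraposed: [block_code] and [slalom_diag] exchange roles. *)
Lemma frak_b_in_d_neq : frak_b in_star I #<= frak_d neq_star I.
Proof.
apply: (frak_b_le_d (phi := slalom_diag) (psi := block_code) pI).
  by move=> s x sx /in_star_block_diagN; exact.
move=> x; exists (succ_baire x); apply: le_star_neq_succ; exact: le_star_refl.
Qed.

Lemma frak_b_le_d_le : frak_b le_star I #<= frak_d le_star I.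
Proof.
apply: (frak_b_le_d (phi := succ_baire) (psi := id) pI).
  by move=> x y; exact: le_star_succN.
by move=> x; exists x; exact: le_star_refl.
Qed.

End cichon.

Theorem theorem1p1 (R : realType) :
  (let N := null_ideal R in
   [/\ frak_b in_star N #<= frak_b le_star N,
       frak_b le_star N #<= frak_b neq_star N
     & frak_b neq_star N #<= frak_d in_star N] /\
   [/\ frak_b in_star N #<= frak_d neq_star N,
       frak_d neq_star N #<= frak_d le_star N
     & frak_d le_star N #<= frak_d in_star N] /\
   frak_b le_star N #<= frak_d le_star N) /\
  (let M := meager_ideal in
   [/\ frak_b in_star M #<= frak_b le_star M,
       frak_b le_star M #<= frak_b neq_star M
     & frak_b neq_star M #<= frak_d in_star M] /\
   [/\ frak_b in_star M #<= frak_d neq_star M,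
       frak_d neq_star M #<= frak_d le_star M
     & frak_d le_star M #<= frak_d in_star M] /\
   frak_b le_star M #<= frak_d le_star M) /\
  (let K := sigma_compact_ideal in
   (frak_b in_star K #<= frak_b le_star K /\
    frak_b le_star K #<= frak_b neq_star K) /\
   (frak_d neq_star K #<= frak_d le_star K /\
    frak_d le_star K #<= frak_d in_star K)) /\
  (let M := meager_ideal in let K := sigma_compact_ideal in
   (frak_b in_star K #<= frak_b in_star M /\
    frak_d in_star M #<= frak_d in_star K) /\
   (frak_b le_star K #<= frak_b le_star M /\
    frak_d le_star M #<= frak_d le_star K) /\
   (frak_b neq_star K #<= frak_b neq_star M /\
    frak_d neq_star M #<= frak_d neq_star K)).

Proof.
have pN := null_proper R; have pM := meager_proper.
have pK := sigma_compact_proper; have KM := sigma_compact_meager.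
have le_ex x : exists y, le_star x y by exists x; exact: le_star_refl.
have neq_ex x : exists y, neq_star x y.
  by exists (succ_baire x); exact/le_star_neq_succ/le_star_refl.
do !split; try solve [exact: frak_b_in_le | exact: frak_b_le_neq
  | exact: frak_d_neq_le | exact: frak_d_le_in | exact: frak_b_neq_d_in
  | exact: frak_b_in_d_neq | exact: frak_b_le_d_le].
(* What remains compares two ideals for one relation: identity translations, with the inclusion [KM]
   doing the work. *)
- exact: (frak_b_tukey (phi := id) (psi := id) pM KM (fun _ _ => id) in_star_exN).
- exact: (frak_d_tukey (phi := id) (psi := id) pK pM KM (fun _ _ => id) in_star_ex).
- exact: (frak_b_tukey (phi := id) (psi := id) pM KM (fun _ _ => id) le_star_exN).
- exact: (frak_d_tukey (phi := id) (psi := id) pK pM KM (fun _ _ => id) le_ex).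
- exact: (frak_b_tukey (phi := id) (psi := id) pM KM (fun _ _ => id) neq_star_exN).
- exact: (frak_d_tukey (phi := id) (psi := id) pK pM KM (fun _ _ => id) neq_ex).
Qed.
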